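(* Let $K$ be a field, $S=K[x_1,\ldots,x_n]$, let $G$ be a finite simple graph with vertex set $\{x_1,\ldots,x_n\}$ and edge ideal $I(G)\subset S$, and let $\mathfrak{c}\in\mathbb{N}^n$. For every positive integer $s\leq\delta_{\mathfrak{c}}(I(G))$, we have $$\operatorname{reg}\big((I(G)^s)_{\mathfrak{c}}\big)\leq \delta_{\mathfrak{c}}(I(G))+s.$$
   Context: $\mathbb{N}$ is the set of nonnegative integers. The edge ideal of $G$ is $I(G)=(x_ix_j : x_ix_j\in E(G))\subset S$. For $\mathfrak{c}=(c_1,\ldots,c_n)\in\mathbb{N}^n$, a monomial $x_1^{a_1}\cdots x_n^{a_n}$ is $\mathfrak{c}$-bounded if $a_i\leq c_i$ for all $i$. For a monomial ideal $I\subset S$, $I_{\mathfrak{c}}$ denotes the ideal generated by all $\mathfrak{c}$-bounded monomials belonging to $I$. The number $\delta_{\mathfrak{c}}(I)$ is the largest integer $k$ such that $(I^k)_{\mathfrak{c}}\neq 0$ (with $I^0=S$). For a finitely generated graded $S$-module $M$ with graded Betti numbers $\beta_{i,j}(M)$, the Castelnuovo--Mumford regularity is $\operatorname{reg}(M)=\max\{j-i : \beta_{i,j}(M)\neq 0\}$; the regularity of an ideal is its regularity as an $S$-module. *)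

(* Defs.v *)
From HB Require Import structures.
From mathcomp Require Import all_boot all_order all_algebra.
From mathcomp.multinomials Require Import freeg mpoly.

Set Implicit Arguments.
Unset Strict Implicit.
Unset Printing Implicit Defensive.

Import Order.TTheory GRing.Theory Num.Theory.
Local Open Scope ring_scope.

Section Ideals.
Variables (K : fieldType) (n : nat).
Local Notation S := {mpoly K[n]}.

(* Ideals of S are handled as membership predicates S -> Prop. *)
Definition ideal_gen (A : S -> Prop) (f : S) : Prop :=
  exists (r : nat) (a g : 'I_r -> S),
    (forall k, A (g k)) /\ f = \sum_(k < r) a k * g k.

(* For k = 0 the only generator is the empty product 1, so I^0 = S. *)
Definition ideal_pow (I : S -> Prop) (k : nat) : S -> Prop :=
  ideal_gen (fun f => exists g : 'I_k -> S,
    (forall i, I (g i)) /\ f = \prod_(i < k) g i).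

Definition edge_ideal (e : rel 'I_n) : S -> Prop :=
  ideal_gen (fun f => exists i j : 'I_n, e i j /\ f = 'X_i * 'X_j).

(* (m <= c)%MM is the componentwise order on exponent vectors. *)
Definition bounded_part (c : 'X_{1..n}) (I : S -> Prop) : S -> Prop :=
  ideal_gen (fun f => exists m : 'X_{1..n},
    [/\ (m <= c)%MM, f = 'X_[m] & I 'X_[m]]).

Definition ideal_neq0 (I : S -> Prop) : Prop := exists2 f, I f & f != 0.

Definition is_delta (c : 'X_{1..n}) (I : S -> Prop) (k : nat) : Prop :=
  ideal_neq0 (bounded_part c (ideal_pow I k)) /\
  forall l : nat, ideal_neq0 (bounded_part c (ideal_pow I l)) -> (l <= k)%N.

End Ideals.

Arguments edge_ideal K {n} e.

Section Resolutions.
Variables (K : fieldType) (n : nat).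
Local Notation S := {mpoly K[n]}.

(* Homogeneous of degree z, where z may be negative; 0 is homogeneous of every
   degree, and the only polynomial homogeneous of a negative degree. *)
Definition zhomog (z : int) (f : S) : Prop :=
  forall m, m \in msupp f -> (mdeg m)%:Z = z.

(* The data of  ... -> F_2 -> F_1 -> F_0 -> S, where
   F_i = \bigoplus_(p < fc_rank i) S(- fc_shift p) consists of row vectors and
   every map is right multiplication by a matrix. *)
Record free_complex := FreeComplex {
  fc_rank : nat -> nat;
  fc_shift : forall i, 'I_(fc_rank i) -> int;
  fc_aug : 'cV[S]_(fc_rank 0);
  fc_diff : forall i, 'M[S]_(fc_rank i.+1, fc_rank i)
}.

(* F is a minimal graded free resolution of the ideal I, seen as an S-module:
   the maps have degree 0, ... -> F_1 -> F_0 -> I -> 0 is exact, and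
   F_(i+1) is mapped into (x_1, ..., x_n) F_i. *)
Record minimal_resolution (I : S -> Prop) (F : free_complex) : Prop := {
  mr_aug_homog : forall p, zhomog (fc_shift p) (fc_aug F p 0);
  mr_diff_homog : forall i p q,
    zhomog (fc_shift p - fc_shift q) (fc_diff F i p q);
  mr_aug_image : forall f : S,
    I f <-> exists v : 'rV[S]_(fc_rank F 0), (v *m fc_aug F) 0 0 = f;
  mr_exact0 : forall v : 'rV[S]_(fc_rank F 0),
    v *m fc_aug F = 0 <->
    exists w : 'rV[S]_(fc_rank F 1), v = w *m fc_diff F 0;
  mr_exactS : forall i (v : 'rV[S]_(fc_rank F i.+1)),
    v *m fc_diff F i = 0 <->
    exists w : 'rV[S]_(fc_rank F i.+2), v = w *m fc_diff F i.+1;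
  mr_minimal : forall i p q, (fc_diff F i p q)@_0%MM = 0
}.

Definition graded_betti (F : free_complex) (i : nat) (j : int) : nat :=
  #|[set p : 'I_(fc_rank F i) | fc_shift p == j]|.

(* r = max {j - i | beta_(i,j) != 0}.  When F is a minimal graded free
   resolution of M, the beta_(i,j), hence r, only depend on M. *)
Definition is_regularity (F : free_complex) (r : int) : Prop :=
  (exists (i : nat) (j : int), graded_betti F i j != 0%N /\ j - i%:Z = r) /\
  forall (i : nat) (j : int), graded_betti F i j != 0%N -> j - i%:Z <= r.

End Resolutions.

(* Main.v *)
Require Import Defs.
From HB Require Import structures.
From mathcomp Require Import all_boot all_order all_algebra.
From mathcomp Require Import zify.
From mathcomp.multinomials Require Import freeg mpoly.
From Stdlib Require Import Classical.

Set Implicit Arguments.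
Unset Strict Implicit.
Unset Printing Implicit Defensive.

Import Order.TTheory GRing.Theory Num.Theory.
Local Open Scope ring_scope.

(* The ideal (I^s)_c is spanned by the monomials x^u for which some s-edge
   multiset has degree vector at most min(u, c).  More generally let J(c, A) be
   spanned by the u for which some s-edge multiset has degree vector at most
   min(u + A, c).  For a variable x_w,
     J(c, A) : x_w = J(c, A + e_w),
     J(c, A) = J(c', A) + x_w J(c, A + e_w),
   where c' is c with c_w lowered to A_w, and a long exact sequence gives
     reg J(c, A) <= max (reg J(c', A), reg J(c, A + e_w) + 1).
   If M is a maximum multiset of edges with degree vector at most c, then
     reg J(c, A) <= max (0, |M| + s - sum_i min(A_i, deg_M i))
   by induction on |c| - |A|: one splits at a vertex w with A_w < deg_M w, so
   that A + e_w lowers the bound by 1, while lowering c_w does not raise it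
   because M can be switched along an alternating path starting at w.

   Regularity is measured with the Koszul complex, on which cycles of positive
   multidegree are contracted by an explicit homotopy; dimension shifting along
   the given minimal resolution turns the vanishing of Koszul homology into a
   bound on its shifts. *)

(** * Supports of polynomials and division by a variable *)

Section Monomials.
Variables (K : fieldType) (n : nat).
Local Notation S := {mpoly K[n]}.
Implicit Types (P Q : 'X_{1..n} -> Prop) (f g : S) (m : 'X_{1..n}) (w : 'I_n).

Definition supported P f := forall m, f@_m != 0 -> P m.

Lemma supported0 P : supported P 0.
Proof. by move=> m; rewrite mcoeff0 eqxx. Qed.

Lemma supportedD P f g : supported P f -> supported P g -> supported P (f + g).
Proof.
move=> Pf Pg m; rewrite mcoeffD.
have [f0|/Pf //] := eqVneq (f@_m) 0.
by rewrite f0 add0r => /Pg.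
Qed.

Lemma supportedN P f : supported P f -> supported P (- f).
Proof. by move=> Pf m; rewrite mcoeffN oppr_eq0; apply: Pf. Qed.

Lemma supportedB P f g : supported P f -> supported P g -> supported P (f - g).
Proof. by move=> Pf Pg; apply: supportedD => //; apply: supportedN. Qed.

Lemma supported_sum P (I : Type) (r : seq I) (F : I -> S) :
  (forall i, supported P (F i)) -> supported P (\sum_(i <- r) F i).
Proof.
move=> PF; elim/big_ind: _ => // [|f g]; first exact: supported0.
exact: supportedD.
Qed.

Lemma supportedW P Q f : (forall m, P m -> Q m) -> supported P f -> supported Q f.
Proof. by move=> PQ Pf m /Pf /PQ. Qed.

Lemma supportedM P Q (R : _ -> Prop) f g :
  (forall m m', P m -> Q m' -> R (m + m')%MM) ->
  supported P f -> supported Q g -> supported R (f * g).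
Proof.
move=> PQR Pf Qg m; rewrite -mcoeff_msupp => /msuppM_le.
case/allpairsP=> -[m1 m2] /= [m1f m2g ->]; apply: PQR.
  by apply: Pf; rewrite -mcoeff_msupp.
by apply: Qg; rewrite -mcoeff_msupp.
Qed.

Lemma supportedX P m : P m -> supported P ('X_[K, m]).
Proof.
by move=> Pm k; rewrite mcoeffX; case: (eqVneq m k) => [<-|]; rewrite ?eqxx.
Qed.

Lemma mcoeffXM_addU w f m : ('X_w * f)@_(m + U_(w)) = f@_m.
Proof. by rewrite mulrC addmC mcoeffMX. Qed.

Lemma submUK m w : m w != 0%N -> (m - U_(w) + U_(w))%MM = m.
Proof. by rewrite -lep1mP => /submK. Qed.

Lemma mcoeffXM w f m :
  ('X_w * f)@_m = if m w == 0%N then 0 else f@_(m - U_(w)).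
Proof.
case: ifPn => [/eqP mw0|mw]; last by rewrite -{1}(submUK mw) mcoeffXM_addU.
apply/eqP; apply: contraT; rewrite -mcoeff_msupp => /msuppM_le.
case/allpairsP=> -[m1 m2] /= [+ _ mE]; rewrite msuppX inE => /eqP m1E.
by move: mw0; rewrite mE m1E mnmDE mnm1E eqxx.
Qed.

(** The quotient of f by x_w; the bound [msize f] makes the sum finite and loses nothing, since
    larger exponents have coefficient 0. *)
Definition divX w f : S :=
  \sum_(m : 'X_{1..n < msize f}) f@_(m + U_(w)) *: 'X_[m].

Definition modX w f : S := f - 'X_w * divX w f.

Lemma divX_coeff w f m : (divX w f)@_m = f@_(m + U_(w)).
Proof.
have [le_m|le_m] := ltnP (mdeg m) (msize f).
  by rewrite (mcoeff_mpoly (fun m => f@_(m + U_(w)))).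
rewrite [RHS]memN_msupp_eq0; last first.
  by apply: msize_mdeg_ge; rewrite mdegD; apply: leq_trans le_m (leq_addr _ _).
rewrite raddf_sum /= big1 // => -[k /= lt_k] _.
rewrite mcoeffZ mcoeffX; case: eqP => [km|]; last by rewrite mulr0.
by rewrite km ltnNge le_m in lt_k.
Qed.

Lemma modX_coeff w f m : (modX w f)@_m = if m w == 0%N then f@_m else 0.
Proof.
rewrite mcoeffB mcoeffXM; case: ifPn => [_|mw]; first by rewrite subr0.
by rewrite divX_coeff submUK // subrr.
Qed.

Lemma divX_modX w f : f = modX w f + 'X_w * divX w f.
Proof. by rewrite subrK. Qed.

Fact divX_is_additive w : zmod_morphism (divX w).
Proof. by move=> f g; apply/mpolyP => m; rewrite mcoeffB !divX_coeff mcoeffB. Qed.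
HB.instance Definition _ w :=
  GRing.isZmodMorphism.Build S S (divX w) (divX_is_additive w).

Fact modX_is_additive w : zmod_morphism (modX w).
Proof.
move=> f g; apply/mpolyP => m; rewrite [RHS]mcoeffB !modX_coeff mcoeffB.
by case: ifP; rewrite ?subr0.
Qed.
HB.instance Definition _ w :=
  GRing.isZmodMorphism.Build S S (modX w) (modX_is_additive w).

Lemma divXX w f : divX w ('X_w * f) = f.
Proof. by apply/mpolyP => m; rewrite divX_coeff mcoeffXM_addU. Qed.

Lemma modXX w f : modX w ('X_w * f) = 0.
Proof. by rewrite /modX divXX subrr. Qed.

Lemma divXXneq w i f : i != w -> divX w ('X_i * f) = 'X_i * divX w f.
Proof.
move=> neq; apply/mpolyP => m; rewrite divX_coeff !mcoeffXM mnmDE mnm1E.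
rewrite [w == i]eq_sym (negPf neq) addn0; case: ifPn => // mi; rewrite divX_coeff.
congr (_@__); apply/mnmP => j; rewrite !mnmE.
case: (eqVneq i j) => [<-|_]; last by rewrite !subn0.
by rewrite eq_sym (negPf neq) !addn0.
Qed.

Lemma modXXneq w i f : i != w -> modX w ('X_i * f) = 'X_i * modX w f.
Proof. by move=> neq; rewrite /modX divXXneq // mulrBr mulrCA. Qed.

Lemma supported_modX P Q w f : (forall m, P m -> m w = 0%N -> Q m) ->
  supported P f -> supported Q (modX w f).
Proof.
move=> PQ Pf m; rewrite modX_coeff; case: (m w =P 0%N) => [mw /Pf /PQ|]; first exact.
by rewrite eqxx.
Qed.

Lemma supported_divX P Q w f : (forall m, P (m + U_(w))%MM -> Q m) ->
  supported P f -> supported Q (divX w f).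
Proof. by move=> PQ Pf m; rewrite divX_coeff => /Pf /PQ. Qed.

Lemma supportedXM P Q w f : (forall m, P m -> Q (m + U_(w))%MM) ->
  supported P f -> supported Q ('X_w * f).
Proof.
move=> PQ; apply: (@supportedM (eq U_(w)%MM)); last exact: supportedX.
by move=> _ m <- /PQ; rewrite addmC.
Qed.

Lemma supported_divXM P Q w f : (forall m, P (m + U_(w))%MM -> Q m) ->
  supported P ('X_w * f) -> supported Q f.
Proof. by move=> PQ Pf m; rewrite -(mcoeffXM_addU w) => /Pf /PQ. Qed.

End Monomials.

(** * The Koszul complex and its contraction *)

Section Koszul.
Variables (K : fieldType) (n : nat).
Local Notation S := {mpoly K[n]}.
Implicit Types (P Q : 'X_{1..n} -> Prop) (f g : S) (s : seq 'I_n) (w : 'I_n).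

Fixpoint koszul_rank s : nat :=
  if s is _ :: s' then koszul_rank s' + koszul_rank s' else 1.

(* A pair (a, b) stands for a + e_w /\ b, where e_w is the basis vector of the
   variable x_w; the differential sends it to (d a + x_w b, - d b). *)
Fixpoint koszul s : 'M[S]_(koszul_rank s) :=
  if s is w :: s' then block_mx (koszul s') ('X_w)%:M 0 (- koszul s') else 0.

Lemma koszulK s : koszul s *m koszul s = 0.
Proof.
elim: s => [|w s IH] /=; first by rewrite mulmx0.
rewrite mulmx_block IH !(mulmx0, mul0mx) !addr0 add0r !(mulmxN, mulNmx) IH.
by rewrite mul_mx_scalar mul_scalar_mx subrr !oppr0 -[RHS]block_mx0.
Qed.

Lemma koszul_supported s i j :
  supported (fun m => exists w, m = U_(w)%MM) (koszul s i j).
Proof.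
elim: s i j => [|w s IH] i j /=; first by rewrite mxE; apply: supported0.
rewrite /block_mx; case: (split_ordP i) => i' ->; rewrite ?(col_mxEu, col_mxEd);
  case: (split_ordP j) => j' ->; rewrite ?(row_mxEl, row_mxEr) //.
- rewrite mxE; case: eqP => _; last by rewrite mulr0n; apply: supported0.
  by rewrite mulr1n; apply: supportedX; exists w.
- by rewrite mxE; apply: supported0.
- by rewrite mxE; apply: supportedN.
Qed.

Lemma supported_koszulM P Q s l (z : 'M[S]_(koszul_rank s, l)) j :
  (forall m w, P m -> Q (m + U_(w))%MM) ->
  (forall i, supported P (z i j)) ->
  forall i, supported Q ((koszul s *m z) i j).
Proof.
move=> PQ Pz i; rewrite mxE; apply: supported_sum => k.
apply: supportedM (Pz k); last exact: koszul_supported.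
by move=> m m' [w ->] /PQ; rewrite addmC.
Qed.

(** Entries of the matrix are 0 or signed variables of [s], so additivity and compatibility with
    these variables suffice; [modX w] and [divX w] are not S-linear. *)
Lemma koszul_map (phi : {additive S -> S}) s l (z : 'M[S]_(koszul_rank s, l)) :
  (forall i f, i \in s -> phi ('X_i * f) = 'X_i * phi f) ->
  map_mx phi (koszul s *m z) = koszul s *m map_mx phi z.
Proof.
elim: s z => [|i s IH] z phiX; first by rewrite /= !mul0mx map_mx0.
have {}IH (y : 'M_(koszul_rank s, l)) :
    map_mx phi (koszul s *m y) = koszul s *m map_mx phi y.
  by apply: IH => k f ks; apply: phiX; rewrite inE ks orbT.
rewrite /= -[z]vsubmxK map_col_mx !mul_block_col map_col_mx !map_mxD.
rewrite !mul0mx map_mx0 !add0r !mulNmx map_mxN !IH; congr (col_mx (_ + _) _).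
rewrite !mul_scalar_mx.
by apply/matrixP => a b; rewrite !mxE phiX ?mem_head.
Qed.

Lemma koszul_map_modX w s l (z : 'M[S]_(koszul_rank s, l)) : w \notin s ->
  map_mx (modX w) (koszul s *m z) = koszul s *m map_mx (modX w) z.
Proof.
move=> ws; apply: koszul_map => i f si; apply: modXXneq.
by apply: contraNneq ws => <-.
Qed.

Lemma koszul_map_divX w s l (z : 'M[S]_(koszul_rank s, l)) : w \notin s ->
  map_mx (divX w) (koszul s *m z) = koszul s *m map_mx (divX w) z.
Proof.
move=> ws; apply: koszul_map => i f si; apply: divXXneq.
by apply: contraNneq ws => <-.
Qed.

(* On a multidegree with support meeting s, this is the contraction
   "divide by x_w and wedge with e_w" for the first w of s in the support. *)
Fixpoint koszul_htpy l s : 'M[S]_(koszul_rank s, l) -> 'M[S]_(koszul_rank s, l) :=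
  if s is w :: s' return 'M_(koszul_rank s, l) -> 'M_(koszul_rank s, l) then
    fun z => col_mx (koszul_htpy (map_mx (modX w) (usubmx z)))
                    (map_mx (divX w) (usubmx z))
  else fun=> 0.

(** The defect of the homotopy: the exterior degree 0 component with all variables of [s] set to
    0. *)
Fixpoint koszul_const l s : 'M[S]_(koszul_rank s, l) -> 'M[S]_(koszul_rank s, l) :=
  if s is w :: s' return 'M_(koszul_rank s, l) -> 'M_(koszul_rank s, l) then
    fun z => col_mx (koszul_const (map_mx (modX w) (usubmx z))) 0
  else id.

(** Induction on [s]: for z = (a, b) the two images of [divX w a] under the differential cancel by
    its sign, and [modX w a] plus x_w times [divX w a] restores a. *)
Lemma koszul_htpyP s l (z : 'M[S]_(koszul_rank s, l)) : uniq s ->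
  koszul s *m koszul_htpy z + koszul_htpy (koszul s *m z) = z - koszul_const z.
Proof.
elim: s z => [|w s IH] z /=; first by rewrite mul0mx addr0 subrr.
case/andP=> ws us; rewrite -[z]vsubmxK; set a := usubmx z; set b := dsubmx z.
rewrite !mul_block_col !col_mxKu !(mul0mx, add0r) opp_col_mx !add_col_mx oppr0 addr0.
rewrite !mul_scalar_mx !map_mxD koszul_map_modX // koszul_map_divX //.
have -> : map_mx (modX w) ('X_w *: b) = 0.
  by apply/matrixP => i j; rewrite !mxE modXX.
have -> : map_mx (divX w) ('X_w *: b) = b.
  by apply/matrixP => i j; rewrite !mxE divXX.
rewrite addr0 addrAC IH // mulNmx addKr; congr col_mx.
rewrite addrAC; congr (_ - _).
by apply/matrixP => i j; rewrite !mxE -divX_modX.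
Qed.

Lemma koszul_const_eq0 s l (z : 'M[S]_(koszul_rank s, l)) :
  (forall i j, supported (fun m => has (fun w => m w != 0%N) s) (z i j)) ->
  koszul_const z = 0.
Proof.
elim: s z => [|w s IH] z sz /=.
  apply/matrixP => i j; rewrite mxE; apply/mpolyP => m; rewrite mcoeff0.
  by apply/eqP; apply: contraT => /sz.
rewrite IH ?col_mx0 // => i j; rewrite !mxE.
by apply: supported_modX (sz _ _) => m /= /orP[/eqP|].
Qed.

Lemma koszul_htpy_supported s P Q l (z : 'M[S]_(koszul_rank s, l)) j :
  (forall m w, P (m + U_(w))%MM -> Q m) ->
  (forall i, supported P (z i j)) -> forall i, supported Q (koszul_htpy z i j).
Proof.
move=> PQ; elim: s z => [|w s IH] z Pz i /=; first by rewrite mxE; apply: supported0.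
case: (split_ordP i) => k ->; rewrite ?(col_mxEu, col_mxEd).
  by apply: IH => {}i; rewrite !mxE; apply: supported_modX (Pz _).
by rewrite !mxE; apply: supported_divX (Pz _) => m /PQ.
Qed.

Lemma koszul_htpy0 s l : koszul_htpy (0 : 'M[S]_(koszul_rank s, l)) = 0.
Proof.
elim: s => //= w s IH.
by rewrite linear0 !map_mx0 IH col_mx0.
Qed.

Lemma koszul_exact l (z : 'M[S]_(koszul_rank (enum 'I_n), l)) :
  koszul (enum 'I_n) *m z = 0 -> (forall i j, (z i j)@_0%MM = 0) ->
  koszul (enum 'I_n) *m koszul_htpy z = z.
Proof.
move=> zK z0; have := koszul_htpyP z (enum_uniq _).
rewrite zK [koszul_const z]koszul_const_eq0 ?subr0.
  by rewrite koszul_htpy0 addr0.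
move=> i j m zm; apply: contraT => /hasPn m0.
suff mE : m = 0%MM by rewrite mE z0 eqxx in zm.
by apply/mnmP => k; rewrite mnm0E; apply/eqP; rewrite -[_ == _]negbK m0 // mem_enum.
Qed.

(** The unit of the exterior algebra, a cycle that will detect the basis elements of a minimal
    resolution. *)
Lemma koszul_unit s : exists (u : 'cV[S]_(koszul_rank s)) t,
  [/\ koszul s *m u = 0, u t 0 = 1 & forall i, supported (eq 0%MM) (u i 0)].
Proof.
elim: s => [|w s [u [t [uK ut us]]]] /=.
  exists 1, 0; split=> [||i]; rewrite ?mul0mx ?mxE ?eqxx //.
  by rewrite ord1 eqxx mulr1n -mpolyX0; apply: supportedX.
exists (col_mx u 0), (lshift _ t); split=> [||i].
- by rewrite mul_block_col uK !(mulmx0, mul0mx) !addr0 col_mx0.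
- by rewrite col_mxEu.
- case: (split_ordP i) => k ->; rewrite ?(col_mxEu, col_mxEd) //.
  by rewrite mxE; apply: supported0.
Qed.

End Koszul.

(** * Regularity via Koszul homology *)

Section Regularity.
Variables (K : fieldType) (n : nat).
Local Notation S := {mpoly K[n]}.
Local Notation N := (koszul_rank (enum 'I_n)).
Local Notation D := (koszul K (enum 'I_n)).

Definition upset (U : 'X_{1..n} -> Prop) :=
  forall m w, U m -> U (m + U_(w))%MM.

Definition in_order (U : 'X_{1..n} -> Prop) (d : int) m :=
  U m /\ d <= (mdeg m)%:Z.

(* For the monomial ideal I spanned by U this says that the Koszul homology
   H_i(x; I), i.e. Tor_i(I, K), vanishes in internal degrees above r + i: on
   its part of internal degree j the coefficients have degree j - i, so the
   homological degree i need not be mentioned. *)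
Definition reg_le (U : 'X_{1..n} -> Prop) (r : nat) :=
  forall (d : int) (z : 'cV[S]_N), r%:Z < d -> D *m z = 0 ->
    (forall i, supported (in_order U d) (z i 0)) ->
  exists2 y : 'cV[S]_N, D *m y = z &
    forall i, supported (in_order U (d - 1)) (y i 0).

Lemma reg_leW U r r' : (r <= r')%N -> reg_le U r -> reg_le U r'.
Proof. by move=> le_r Ur d z lt_d; apply: Ur; lia. Qed.

Lemma reg_le_empty U r : (forall m, ~ U m) -> reg_le U r.
Proof.
move=> U0 d z _ _ Uz; exists 0 => [|i]; last by rewrite mxE; apply: supported0.
rewrite mulmx0; apply/matrixP => i j; rewrite mxE ord1; apply/mpolyP => m.
by rewrite mcoeff0; apply/esym/eqP; apply: contraT => /Uz [] /U0.
Qed.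

(** For d > 0 the cycles have no constant terms, so the homotopy contracts them; it lowers the order
    by 1. *)
Lemma reg_le_full U r : (forall m, U m) -> reg_le U r.
Proof.
move=> Uall d z lt_d zK Uz; exists (koszul_htpy z) => [|i].
  apply: koszul_exact => // i j; rewrite ord1; apply/eqP; apply: contraT.
  by move=> /Uz [_]; rewrite mdeg0; lia.
apply: koszul_htpy_supported Uz i => m w [_]; rewrite mdegD mdeg1 => ?.
by split=> //; lia.
Qed.

(* I = I' + x_w L with I' \cap x_w L = x_w I', where U, U' and UL span I, I' and
   L: the long exact sequence of 0 -> I'(-1) -> I' (+) L(-1) -> I -> 0. *)
Lemma reg_le_split (U U' UL : 'X_{1..n} -> Prop) w r : upset U' ->
  (forall m, U m -> m w = 0%N -> U' m) ->
  (forall m, U (m + U_(w))%MM <-> UL m) ->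
  (forall m, U' m -> U m) -> (forall m, U' m -> UL m) ->
  (forall m, U' (m + U_(w))%MM -> U' m) ->
  reg_le U' r.+1 -> reg_le UL r -> reg_le U r.+1.
Proof.
move=> upU' UU' UUL U'U U'UL U'w regU' regUL d z lt_d zK Uz.
pose a := map_mx (modX w) z; pose b := map_mx (divX w) z.
have XM (M : 'cV[S]_N) i : ('X_w *: M) i 0 = 'X_w * M i 0 by rewrite mxE.
have zE : z = a + 'X_w *: b by apply/matrixP => i j; rewrite !mxE -divX_modX.
have Ua i : supported (in_order U' d) (a i 0).
  rewrite mxE; apply: supported_modX (Uz i) => m [Um dm] mw.
  by split=> //; apply: UU'.
have Ub i : supported (in_order UL (d - 1)) (b i 0).
  rewrite mxE; apply: supported_divX (Uz i) => m [/UUL Um].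
  by rewrite mdegD mdeg1 => dm; split=> //; lia.
have eDb : 'X_w *: (D *m b) = - (D *m a).
  by apply/eqP; rewrite -addr_eq0 addrC scalemxAr -mulmxDr -zE zK.
(* Since x_w D b = - D a lies in I' and I' allows division by x_w, D b is supported in I'. *)
have UDb i : supported (in_order U' d) ((D *m b) i 0).
  have U1 : supported U' ((D *m b) i 0).
    apply: (@supported_divXM _ _ U' _ w) => //.
    have -> : 'X_w * (D *m b) i 0 = - (D *m a) i 0.
      by move/matrixP/(_ i 0): eDb; rewrite mxE [RHS]mxE.
    apply: supportedN; apply: (supported_koszulM _ Ua) => m k [Um _].
    exact: upU'.
  have U2 : supported (fun m => d <= (mdeg m)%:Z) ((D *m b) i 0).
    apply: (supported_koszulM _ Ub) => m k [_]; rewrite mdegD mdeg1; lia.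
  by move=> m nz; split; [apply: U1|apply: U2].
(* Correcting b by b' makes b - b' a cycle over L, of order d - 1 > r, and a + x_w b' a cycle over
   I'. *)
have [|b' b'E Ub'] := regU' d _ lt_d _ UDb.
  by rewrite mulmxA koszulK mul0mx.
have [||i|b2 b2E Ub2] := regUL (d - 1) (b - b').
- lia.
- by rewrite mulmxBr b'E subrr.
- rewrite mxE [(- b') i 0]mxE; apply: supportedB => //.
  by apply: supportedW (Ub' i) => m [/U'UL].
have [|i|a2 a2E Ua2] := regU' d (a + 'X_w *: b') lt_d.
- by rewrite mulmxDr -scalemxAr b'E eDb subrr.
- rewrite mxE XM; apply: supportedD => //.
  apply: supportedXM (Ub' i) => m [/upU' Um dm].
  by split; [exact: Um|rewrite mdegD mdeg1; lia].
exists (a2 + 'X_w *: b2) => [|i].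
  by rewrite mulmxDr -scalemxAr a2E b2E zE scalerBr addrA addrAC addrK.
rewrite mxE XM; apply: supportedD.
  by apply: supportedW (Ua2 i) => m [/U'U].
apply: supportedXM (Ub2 i) => m [/UUL Um dm].
by split; [exact: Um|rewrite mdegD mdeg1; lia].
Qed.

Definition order_ge (d : int) (f : S) := supported (fun m => d <= (mdeg m)%:Z) f.

(* The analogue of reg_le for the row space of B, a submodule of a graded free
   module whose generators have degrees a. *)
Definition mx_reg_le l k (B : 'M[S]_(l, k)) (a : 'I_k -> int) (r : int) :=
  forall (d : int) (v : 'M[S]_(N, l)), r < d -> D *m (v *m B) = 0 ->
    (forall i q, order_ge (d - a q) ((v *m B) i q)) ->
  exists y : 'M[S]_(N, l), D *m (y *m B) = v *m B.

Lemma zhomog_order d f : zhomog d f -> order_ge d f.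
Proof. by move=> homf m; rewrite -mcoeff_msupp => /homf ->. Qed.

Lemma row_lift l k o (B : 'M[S]_(l, k)) (C : 'M[S]_(o, l)) :
  (forall v : 'rV[S]_l, v *m B = 0 <-> exists w, v = w *m C) ->
  forall p (v : 'M[S]_(p, l)), v *m B = 0 -> exists w, v = w *m C.
Proof.
move=> ex p v vB.
have row_ex i : exists w : 'rV_o, row i v = w *m C.
  by apply/ex; rewrite -row_mul vB row0.
have [w wE] := fin_all_exists row_ex.
exists (\matrix_i w i); apply/row_matrixP => i.
by rewrite row_mul rowK.
Qed.

Lemma mcoeff0M (f g : S) : (f * g)@_0%MM = f@_0%MM * g@_0%MM.
Proof. exact: (rmorphM (mcoeff 0%MM)). Qed.

Lemma mcoeff0_mulmx l k o (B : 'M[S]_(l, k)) (C : 'M[S]_(o, l)) i j :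
  (forall p, (B p j)@_0%MM = 0) -> ((C *m B) i j)@_0%MM = 0.
Proof.
move=> B0; rewrite mxE raddf_sum big1 //= => p _.
by rewrite mcoeff0M B0 mulr0.
Qed.

Section Step.
Variables (l k o : nat) (B : 'M[S]_(l, k)) (C : 'M[S]_(o, l)).
Variables (a : 'I_k -> int) (b : 'I_l -> int) (r : int).
Hypothesis B_homog : forall p q, zhomog (b p - a q) (B p q).
Hypothesis C_minimal : forall p q, (C p q)@_0%MM = 0.
Hypothesis exactBC : forall v : 'rV[S]_l, v *m B = 0 <-> exists w, v = w *m C.
Hypothesis regB : mx_reg_le B a r.

Lemma CB0 : C *m B = 0.
Proof.
apply/row_matrixP => i; rewrite row_mul row0; apply/exactBC.
by exists (row i 1%:M); rewrite -row_mul mul1mx.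
Qed.

(** Dimension shifting. Minimality gives z = D y in the free module; y B is a cycle of order one
    less, so y B = D (y' B), and y - D y' = w C with D (w C) = z. *)
Lemma mx_reg_le_syz : mx_reg_le C b (r + 1).
Proof.
move=> d v lt_d zK z_ord; set z := v *m C in zK z_ord *.
have z0 i j : (z i j)@_0%MM = 0 by apply: mcoeff0_mulmx => p.
have yE := koszul_exact zK z0; set y := koszul_htpy z in yE.
have y_ord i q : order_ge (d - 1 - b q) (y i q).
  apply: koszul_htpy_supported (z_ord^~ q) i => m w.
  by rewrite mdegD mdeg1; lia.
have [||i q|y' y'E] := regB (d := d - 1) (v := y).
- lia.
- by rewrite mulmxA yE -mulmxA CB0 mulmx0.
- rewrite mxE; apply: supported_sum => p.
  apply: (supportedM _ (y_ord i p) (zhomog_order (@B_homog p q))) => m m'.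
  by rewrite mdegD; lia.
have [|w wE] := row_lift exactBC (v := y - D *m y').
  by rewrite mulmxBl -mulmxA y'E subrr.
by exists w; rewrite -wE mulmxBr mulmxA koszulK mul0mx subr0.
Qed.

(** If b_p > r, the cycle u times row p of B bounds some y B, and u e_p - D y is a syzygy, hence
    without constant terms by minimality; but its entry at t, p has constant term 1. *)
Lemma shift_le p : b p <= r.
Proof.
have [//|lt_r] := lerP (b p) r.
have [u [t [uK ut u_supp]]] := koszul_unit K (enum 'I_n).
pose v : 'M[S]_(N, l) := u *m delta_mx 0 p.
have vB : v *m B = u *m row p B by rewrite -mulmxA -rowE.
have [|i q|y yE] := regB (v := v) lt_r.
- by rewrite vB mulmxA uK mul0mx.
- rewrite vB mxE big_ord1 mxE.
  apply: (supportedM _ (u_supp i) (zhomog_order (@B_homog p q))) => m m' <-.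
  by rewrite mdegD mdeg0.
have [|w /matrixP /(_ t p)] := row_lift exactBC (v := v - D *m y).
  by rewrite mulmxBl -(mulmxA D) yE subrr.
move/(congr1 (mcoeff 0%MM)); rewrite (mcoeff0_mulmx _ _ (C_minimal^~ p)).
rewrite mxE mcoeffD !mxE big_ord1 mxE !eqxx mulr1 ut mcoeff1 eqxx.
rewrite raddfN /= raddf_sum big1 ?subr0 /=; last first.
  move=> i _; rewrite mcoeff0M; suff -> : (D t i)@_0%MM = 0 by rewrite mul0r.
  apply/eqP; apply: contraT => /koszul_supported [w' /(congr1 mdeg)].
  by rewrite mdeg0 mdeg1.
by move/eqP; rewrite oner_eq0.
Qed.

End Step.

End Regularity.

(** * Degree vectors of edge multisets and their maxima *)

Section EdgeSums.
Variables (n : nat) (e : rel 'I_n).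
Hypotheses (e_sym : ssrbool.symmetric e) (e_irr : irreflexive e).
Implicit Types (A B c m u M N P : 'X_{1..n}) (i j w x : 'I_n) (k l s p : nat).

(* m is the degree vector of a multiset of k edges. *)
Inductive edge_sum : nat -> 'X_{1..n} -> Prop :=
| EdgeSum0 : edge_sum 0 0%MM
| EdgeSumS k m i j : e i j -> edge_sum k m ->
    edge_sum k.+1 (U_(i) + U_(j) + m)%MM.

Lemma edge_sumD k m l u :
  edge_sum k m -> edge_sum l u -> edge_sum (k + l) (m + u)%MM.
Proof.
move=> mk ul; elim: mk => [|{}k {}m i j eij _ IH]; first by rewrite add0m.
by rewrite addSn -addmA; apply: EdgeSumS.
Qed.

Lemma edge_sum_mdeg k m : edge_sum k m -> mdeg m = k.*2.
Proof. by elim=> [|{}k {}m i j _ _ IH]; rewrite ?mdeg0 // !mdegD !mdeg1 IH. Qed.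

Lemma edge_sum_leq k l m : edge_sum k m -> (l <= k)%N ->
  exists2 u, edge_sum l u & (u <= m)%MM.
Proof.
move=> mk; elim: mk l => [|{}k {}m i j eij mk IH] l.
  by rewrite leqn0 => /eqP ->; exists 0%MM; [exact: EdgeSum0|exact: lepm_refl].
case: l => [_|l /IH[u ul le_u]].
  by exists 0%MM; [exact: EdgeSum0|apply/mnm_lepP => ?; rewrite mnm0E].
exists (U_(i) + U_(j) + u)%MM; first exact: EdgeSumS.
by apply/mnm_lepP => x; rewrite !(mnmDE x) leq_add2l; apply/mnm_lepP.
Qed.

Lemma edge_sum_split k m w : edge_sum k m -> m w != 0%N ->
  exists l x u, [/\ k = l.+1, e w x, edge_sum l u & m = (U_(w) + U_(x) + u)%MM].
Proof.
elim=> [|{}k {}m i j eij mk IH]; first by rewrite mnm0E.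
have [-> _|neq_iw] := eqVneq w i; first by exists k, j, m.
have [-> _|neq_jw] := eqVneq w j.
  by exists k, i, m; split=> //; [rewrite e_sym|rewrite [(U_(j) + _)%MM]addmC].
rewrite !mnmDE !mnm1E ![_ == w]eq_sym (negPf neq_iw) (negPf neq_jw) => /IH.
case=> l [x [u [-> ewx ul ->]]]; exists l.+1, x, (U_(i) + U_(j) + u)%MM.
by split=> //; [apply: EdgeSumS|apply/mnmP => y; rewrite !mnmDE addnCA].
Qed.

(** Together with a multiset of k edges below c, this says that k is delta_c of the edge ideal. *)
Definition edge_max c k := forall l m, edge_sum l m -> (m <= c)%MM -> (l <= k)%N.

(* Switching along the alternating path that starts at w. *)
Lemma edge_sum_exchange k l c N M w :
  edge_sum k N -> (N + U_(w) <= c)%MM -> edge_max c k ->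
  edge_sum l M -> (M <= c)%MM ->
  exists M', [/\ edge_sum l M', (M' + U_(w) <= c)%MM & (M <= M' + U_(w))%MM].
Proof.
elim: l k c N M w => [|l IH] k c N M w Nk Nc max_k Ml Mc.
  exists M; split=> //; last exact: lem_addr.
  inversion Ml; rewrite add0m; apply: lepm_trans Nc; exact: lem_addl.
have [lt_w|le_w] := ltnP (M w) (c w).
  exists M; split=> //; last exact: lem_addr.
  apply/mnm_lepP => i; rewrite mnmDE mnm1E; have := mnm_lepP Mc i.
  by case: eqP => [<-|]; lia.
have Nw := mnm_lepP Nc w; rewrite mnmDE mnm1E eqxx in Nw.
have [|l' [x [M1 [[<-] ewx M1l ME]]]] := edge_sum_split (w := w) Ml; first by lia.
have neq_xw : x != w by apply: contraTneq ewx => ->; rewrite e_irr.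
(* Otherwise adding the edge wx to N would contradict [max_k]. *)
have Nx : c x = N x.
  apply/eqP; rewrite eqn_leq; apply/andP; split; last first.
    by have := mnm_lepP Nc x; rewrite mnmDE; lia.
  rewrite leqNgt; apply/negP => lt_x.
  suff : (k.+1 <= k)%N by rewrite ltnn.
  apply: (max_k _ (U_(w) + U_(x) + N)%MM); first exact: EdgeSumS.
  apply/mnm_lepP => i; have := mnm_lepP Nc i; rewrite !mnmDE !mnm1E.
  have [<-|_] := eqVneq x i; last by lia.
  by rewrite eq_sym (negPf neq_xw); lia.
have Mx := mnm_lepP Mc x; rewrite ME !mnmDE !mnm1E eqxx in Mx.
have [|k' [y [N1 [kE exy N1k NE]]]] := edge_sum_split (w := x) Nk; first by lia.
have c1K i : ((c - (U_(w) + U_(x)))%MM i + (U_(w)%MM i + U_(x)%MM i) = c i)%N.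
  rewrite mnmBE mnmDE subnK //; have := mnm_lepP Nc i.
  by rewrite NE !mnmDE; lia.
(* Removing wx from M and c, and xy from N, leaves the same problem at y; its solution is completed
   by xy in place of wx. *)
have [||||M' [M'l M'c M'M]] := IH k' (c - (U_(w) + U_(x)))%MM N1 M1 y N1k.
- apply/mnm_lepP => i; have := mnm_lepP Nc i; have := c1K i.
  by rewrite NE !mnmDE; lia.
- move=> h m mh m_le; rewrite -ltnS -kE.
  apply: (max_k _ (U_(w) + U_(x) + m)%MM); first exact: EdgeSumS.
  by apply/mnm_lepP => i; have := mnm_lepP m_le i; have := c1K i; rewrite !mnmDE; lia.
- exact: M1l.
- apply/mnm_lepP => i; have := mnm_lepP Mc i; have := c1K i.
  by rewrite ME !mnmDE; lia.
exists (U_(x) + U_(y) + M')%MM; split; first exact: EdgeSumS.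
  by apply/mnm_lepP => i; have := mnm_lepP M'c i; have := c1K i; rewrite !mnmDE; lia.
by apply/mnm_lepP => i; have := mnm_lepP M'M i; rewrite ME !mnmDE; lia.
Qed.

(** The number of half-edges of m that A can absorb. *)
Definition cap A m := (\sum_i minn (A i) (m i))%N.

Lemma leq_cap A m B u (d : 'X_{1..n}) :
  (forall i, minn (A i) (m i) <= minn (B i) (u i) + d i)%N ->
  (cap A m <= cap B u + mdeg d)%N.
Proof. by move=> le_i; rewrite mdegE -big_split; apply: leq_sum. Qed.

(* With A fixed, k - cap A M does not increase when c_w is lowered. *)
Lemma edge_max_delete1 c A k M w :
  edge_sum k M -> (M <= c)%MM -> edge_max c k -> (A + U_(w) <= c)%MM ->
  exists k' M', [/\ edge_sum k' M', (M' <= c - U_(w))%MM,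
    edge_max (c - U_(w))%MM k' & (k' + cap A M <= k + cap A M')%N].
Proof.
move=> Mk Mc max_k Ac.
have Aw := mnm_lepP Ac w; rewrite mnmDE mnm1E eqxx in Aw.
have max_cw : edge_max (c - U_(w))%MM k.
  move=> l m ml le_m; apply: max_k ml _; apply: lepm_trans le_m _.
  exact: lem_subr.
have le_cw m : (m + U_(w) <= c)%MM -> (m <= c - U_(w))%MM.
  move=> le_m; apply/mnm_lepP => i; have := mnm_lepP le_m i.
  by rewrite mnmDE mnmBE; lia.
have [lt_w|le_w] := ltnP (M w) (c w).
  exists k, M; split=> //; apply: le_cw; apply/mnm_lepP => i.
  rewrite mnmDE mnm1E; have := mnm_lepP Mc i.
  by case: eqP => [<-|]; lia.
(* A maximum N with room at w lets the switch free one unit of M at w; as c_w > A_w, the cap does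
   not drop. *)
have [[N Nk Nc]|noN] := classic (exists2 N, edge_sum k N & (N + U_(w) <= c)%MM).
  have [M' [M'k M'c M'M]] := edge_sum_exchange Nk Nc max_k Mk Mc.
  exists k, M'; split=> //; first exact: le_cw.
  rewrite leq_add2l -[cap A M']addn0 -(@mdeg0 n); apply: leq_cap => i.
  have := mnm_lepP M'M i; rewrite mnm0E mnmDE mnm1E.
  by case: eqP => [<-|]; lia.
(* Now every k-edge sum below c fills w, so the maximum for c - e_w is k - 1; dropping an edge wx
   from M costs at most 1 in the cap, namely at x. *)
have [|k' [x [M' [kE ewx M'k ME]]]] := edge_sum_split (w := w) Mk; first by lia.
have neq_xw : x != w by apply: contraTneq ewx => ->; rewrite e_irr.
exists k', M'; split=> //.
- by apply: le_cw; apply/mnm_lepP => i; have := mnm_lepP Mc i; rewrite ME !mnmDE; lia.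
- move=> l m ml le_m; have := max_cw l m ml le_m.
  rewrite kE leq_eqVlt => /orP[/eqP lE|//]; case: noN; exists m.
    by rewrite kE -lE.
  apply/mnm_lepP => i; have := mnm_lepP le_m i; rewrite mnmDE mnmBE mnm1E.
  by case: eqP => [<-|]; lia.
- rewrite kE addSnnS leq_add2l -addn1 -(mdeg1 x); apply: leq_cap => i.
  move: le_w; rewrite ME !mnmDE !mnm1E !eqxx (negPf neq_xw).
  by case: (eqVneq w i) => [<-|]; rewrite ?(negPf neq_xw); lia.
Qed.

Definition mset m w a : 'X_{1..n} := [multinom if i == w then a else m i | i < n].

Lemma msetE m w a i : mset m w a i = if i == w then a else m i.
Proof. exact: mnmE. Qed.

(** Lower c_w one unit at a time: A + e_w <= c holds as long as c_w exceeds A_w. *)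
Lemma edge_max_delete c A k M w :
  edge_sum k M -> (M <= c)%MM -> edge_max c k -> (A <= c)%MM ->
  let c' := mset c w (A w) in
  exists k' M', [/\ edge_sum k' M', (M' <= c')%MM,
    edge_max c' k' & (k' + cap A M <= k + cap A M')%N].
Proof.
move=> + + + Ac; move tE: (c w - A w)%N => t.
elim: t c Ac tE k M => [|t IH] c Ac tE k M Mk Mc max_k c'.
  suff -> : c' = c by exists k, M.
  apply/mnmP => i; rewrite msetE; case: eqP => // ->.
  by have := mnm_lepP Ac w; lia.
have Acw : (A + U_(w) <= c)%MM.
  apply/mnm_lepP => i; have := mnm_lepP Ac i; rewrite mnmDE mnm1E.
  by case: eqP => [<-|]; lia.
have [k1 [M1 [M1k M1c max1 le1]]] := edge_max_delete1 Mk Mc max_k Acw.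
have [|| k2 [M2 [M2k M2c max2 le2]]] := IH (c - U_(w))%MM _ _ k1 M1 M1k M1c max1.
- apply/mnm_lepP => i; have := mnm_lepP Acw i; rewrite mnmDE mnmBE; lia.
- by rewrite mnmBE mnm1E eqxx; lia.
have cE : mset (c - U_(w))%MM w (A w) = c'.
  apply/mnmP => i; rewrite !msetE mnmBE mnm1E eq_sym.
  by case: eqP; rewrite ?subn0.
rewrite cE in M2c max2.
by exists k2, M2; split=> //; lia.
Qed.

(* Mark min (A i, M i) of the half-edges of M at i. The edges with both ends
   marked form P; every other edge has at most one marked end. *)
Lemma edge_sum_marked k M A : edge_sum k M ->
  exists p P, [/\ edge_sum p P, (P <= A)%MM & (cap A M <= k + p)%N].
Proof.
move=> Mk; elim: Mk A => [|{}k {}M i j eij _ IH] A.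
  exists 0%N, 0%MM; split; [exact: EdgeSum0| |].
    by apply/mnm_lepP => x; rewrite mnm0E.
  by rewrite /cap big1 // => x _; rewrite mnm0E minn0.
have neq : i != j by apply: contraTneq eij => ->; rewrite e_irr.
(* An end without a unit of A gets no mark, so this edge adds at most 1 to the cap. *)
have [Ai0|Ai0] := eqVneq (A i) 0%N.
  have [p [P [Pp PA le_cap]]] := IH A; exists p, P; split=> //.
  apply: (@leq_trans (cap A M + mdeg (U_(j)%MM))%N); last by rewrite mdeg1; lia.
  apply: leq_cap => x; rewrite !mnmDE !mnm1E.
  by case: (eqVneq i x) => [<-|]; lia.
have [Aj0|Aj0] := eqVneq (A j) 0%N.
  have [p [P [Pp PA le_cap]]] := IH A; exists p, P; split=> //.
  apply: (@leq_trans (cap A M + mdeg (U_(i)%MM))%N); last by rewrite mdeg1; lia.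
  apply: leq_cap => x; rewrite !mnmDE !mnm1E.
  by case: (eqVneq j x) => [<-|]; lia.
have AK x : ((A - (U_(i) + U_(j)))%MM x + (U_(i)%MM x + U_(j)%MM x) = A x)%N.
  rewrite mnmBE mnmDE subnK // !mnm1E.
  case: (eqVneq i x) => [<-|]; first by rewrite eq_sym (negPf neq); lia.
  by case: (eqVneq j x) => [<-|]; lia.
(* Both ends can be marked: the edge joins P, adding at most 2 to the cap and exactly 2 to k + p. *)
have [p [P [Pp PA le_cap]]] := IH (A - (U_(i) + U_(j)))%MM.
exists p.+1, (U_(i) + U_(j) + P)%MM; split; first exact: EdgeSumS.
  by apply/mnm_lepP => x; have := mnm_lepP PA x; have := AK x; rewrite !mnmDE; lia.
apply: (@leq_trans (cap (A - (U_(i) + U_(j)))%MM M + mdeg (U_(i) + U_(j))%MM)%N).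
  by apply: leq_cap => x; rewrite -(AK x) !mnmDE; lia.
by rewrite mdegD !mdeg1; lia.
Qed.

(* The monomials of ((I^s)_c : x^A), for I the edge ideal and A <= c. *)
Definition colon_mono c A s u :=
  exists P, [/\ edge_sum s P, (P <= u + A)%MM & (P <= c)%MM].

Lemma lem_mdeg m u : (m <= u)%MM -> (mdeg m <= mdeg u)%N.
Proof. by move/mnm_lepP => le_mu; rewrite !mdegE; apply: leq_sum. Qed.

Section Split.
Variables (K : fieldType) (s : nat).

(* If A already contains an s-matching the ideal is S; otherwise some vertex w
   of M is not exhausted by A, and one splits off the variable x_w. *)
Lemma reg_le_colon c A k M : (A <= c)%MM ->
  edge_sum k M -> (M <= c)%MM -> edge_max c k ->
  reg_le K (colon_mono c A s) (k + s - cap A M).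
Proof.
have [t] := ubnP (mdeg c - mdeg A); elim: t c A k M => // t IH c A k M.
rewrite ltnS => le_t Ac Mk Mc max_k.
have [lt_s|le_s] := ltnP k s.
  apply: reg_le_empty => u [P [Ps _ Pc]].
  by have := max_k _ _ Ps Pc; lia.
have [p [P [Pp PA le_cap]]] := edge_sum_marked A Mk.
have [le_p|lt_p] := leqP s p.
  apply: reg_le_full => u; have [P' P's le_P'] := edge_sum_leq Pp le_p.
  have P'A := lepm_trans le_P' PA.
  exists P'; split=> //; last exact: lepm_trans P'A Ac.
  by apply: lepm_trans P'A _; apply: lem_addl.
(* Here cap A M <= k + p < 2k, whereas exhausting every vertex of M would give 2k. *)
have [w lt_w] : exists w, (A w < M w)%N.
  apply/existsP; apply: contraT => /existsPn le_A.
  suff : cap A M = k.*2 by lia.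
  rewrite -(edge_sum_mdeg Mk) mdegE; apply: eq_bigr => i _.
  by have := le_A i; lia.
have Mw := mnm_lepP Mc w.
have Acw : (A + U_(w) <= c)%MM.
  apply/mnm_lepP => i; have := mnm_lepP Ac i; rewrite mnmDE mnm1E.
  by case: eqP => [<-|]; lia.
have := lem_mdeg Acw; rewrite mdegD mdeg1 => lt_Ac.
have capS : cap (A + U_(w))%MM M = (cap A M).+1.
  rewrite -addn1 -(mdeg1 w) mdegE -big_split; apply: eq_bigr => i _ /=.
  by rewrite mnmDE mnm1E; case: eqP => [<-|]; lia.
have [k' [M' [M'k M'c max' le']]] := edge_max_delete w Mk Mc max_k Ac.
set c' := mset c w (A w) in M'c max'.
have c'E i : c' i = if i == w then A w else c i by exact: msetE.
have Ac' : (A <= c')%MM.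
  apply/mnm_lepP => i; rewrite c'E; case: eqP => [->|_] //.
  exact: (mnm_lepP Ac).
have c'c : (c' + U_(w) <= c)%MM.
  apply/mnm_lepP => i; rewrite mnmDE mnm1E c'E [w == i]eq_sym.
  by case: eqP => [->|]; lia.
have := lem_mdeg c'c; rewrite mdegD mdeg1 => lt_c'.
have le_c' : (c' <= c)%MM by apply: lepm_trans c'c; apply: lem_addr.
(* No truncation occurs, as cap A M <= k + p < k + s. *)
have -> : (k + s - cap A M)%N = (k + s - cap (A + U_(w))%MM M).+1 by lia.
apply: (@reg_le_split _ _ _ (colon_mono c' A s) (colon_mono c (A + U_(w))%MM s) w).
- move=> u x [Q [Qs Qu Qc]]; exists Q; split=> //.
  by apply: lepm_trans Qu _; rewrite -addmA [(U_(x) + _)%MM]addmC addmA lem_addr.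
- move=> u [Q [Qs Qu Qc]] uw; exists Q; split=> //; apply/mnm_lepP => i.
  have := mnm_lepP Qu i; have := mnm_lepP Qc i; rewrite c'E mnmDE.
  by case: eqP => [->|_ ? _] //; rewrite uw add0n.
- move=> u; rewrite /colon_mono.
  suff -> : (u + (A + U_(w)) = u + U_(w) + A)%MM by [].
  by rewrite [(A + _)%MM]addmC addmA.
- move=> u [Q [Qs Qu Qc]]; exists Q; split=> //; exact: lepm_trans Qc _.
- move=> u [Q [Qs Qu Qc]]; exists Q; split=> //; last exact: lepm_trans Qc _.
  by apply: lepm_trans Qu _; rewrite addmA lem_addr.
(* As c'_w = A_w, the condition at w does not depend on u_w, so J(c', A) allows division by x_w. *)
- move=> u [Q [Qs Qu Qc]]; exists Q; split=> //; apply/mnm_lepP => i.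
  have := mnm_lepP Qu i; have := mnm_lepP Qc i; rewrite c'E !mnmDE mnm1E.
  rewrite [w == i]eq_sym; case: eqP => [-> Qw _|_ _]; last by rewrite addn0.
  exact: leq_trans Qw (leq_addl _ _).
- by apply: reg_leW (IH c' A k' M' _ Ac' M'k M'c max'); lia.
- by apply: IH => //; rewrite mdegD mdeg1; lia.
Qed.

End Split.
End EdgeSums.

(** * Monomials of the powers of the edge ideal and of their bounded parts *)

Section Ideals.
Variables (K : fieldType) (n : nat) (e : rel 'I_n).
Hypotheses (e_sym : ssrbool.symmetric e) (e_irr : irreflexive e).
Local Notation S := {mpoly K[n]}.
Implicit Types (A : S -> Prop) (c m P : 'X_{1..n}) (f g : S) (k s : nat).

Lemma ideal_gen_mem A g : A g -> ideal_gen A g.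
Proof.
by move=> Ag; exists 1%N, (fun=> 1), (fun=> g); rewrite big_ord1 mul1r.
Qed.

Lemma ideal_gen_supported A (Q : 'X_{1..n} -> Prop) :
  (forall m m', Q m -> Q (m' + m)%MM) -> (forall g, A g -> supported Q g) ->
  forall f, ideal_gen A f -> supported Q f.
Proof.
move=> upQ AQ f [r [a [g [Ag ->]]]]; apply: supported_sum => i.
by apply: (@supportedM _ _ xpredT Q) (AQ _ (Ag i)) => // m m' _ /upQ.
Qed.

Definition above_edge_sum k m := exists2 P, edge_sum e k P & (P <= m)%MM.

Lemma above_edge_sum_up k m m' : above_edge_sum k m -> above_edge_sum k (m' + m)%MM.
Proof. by case=> P Pk Pm; exists P => //; apply: lepm_trans Pm (lem_addl _ _). Qed.

Lemma edge_ideal_supported f : edge_ideal K e f -> supported (above_edge_sum 1) f.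
Proof.
apply: ideal_gen_supported; first exact: above_edge_sum_up.
move=> g [i [j [eij ->]]]; rewrite -mpolyXD; apply: supportedX.
exists (U_(i) + U_(j))%MM; last exact: lepm_refl.
by rewrite -[(U_(i) + _)%MM]addm0; apply: EdgeSumS => //; apply: EdgeSum0.
Qed.

Lemma ideal_pow_supported k f :
  ideal_pow (edge_ideal K e) k f -> supported (above_edge_sum k) f.
Proof.
apply: ideal_gen_supported; first exact: above_edge_sum_up.
move=> _ [g [Ig ->]]; elim: k g Ig => [|k IH] g Ig.
  rewrite big_ord0 -mpolyX0; apply: supportedX.
  by exists 0%MM; [exact: EdgeSum0|exact: lepm_refl].
rewrite big_ord_recl.
apply: (supportedM _ (edge_ideal_supported (Ig _)) (IH _ _)) => // m m'.
move=> [P P1 Pm] [Q Qk Qm']; exists (P + Q)%MM; first exact: (edge_sumD P1 Qk).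
by apply/mnm_lepP => i; rewrite !mnmDE leq_add //; apply/mnm_lepP.
Qed.

Lemma edge_sum_ideal_pow k P :
  edge_sum e k P -> ideal_pow (edge_ideal K e) k 'X_[P].
Proof.
move=> Pk; apply: ideal_gen_mem; elim: Pk => [|{}k {}P i j eij _ [g [Ig gE]]].
  by exists (fun=> 0); split=> [[]//|]; rewrite big_ord0 mpolyX0.
exists (fun q => if unlift ord0 q is Some q' then g q' else 'X_i * 'X_j).
split=> [q|].
  by case: unliftP => [q' _|_]; [exact: Ig|apply: ideal_gen_mem; exists i, j].
rewrite big_ord_recl unlift_none !mpolyXD gE; congr (_ * _).
by apply: eq_bigr => q _; rewrite liftK.
Qed.

(** A c-bounded monomial of I^s lies above an edge sum P, itself c-bounded; conversely, a choice of
    P below each monomial of f expresses f by generators x^P. *)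
Lemma bounded_partP c s f : bounded_part c (ideal_pow (edge_ideal K e) s) f <->
  supported (colon_mono e c 0 s) f.
Proof.
split=> [|f_supp].
  apply: ideal_gen_supported => [m m' [P [Ps Pm Pc]]|_ [m [mc -> Im]]].
    exists P; split=> //; apply: lepm_trans Pm _.
    by rewrite -addmA lem_addl.
  apply: supportedX; have [|P Ps Pm] := ideal_pow_supported Im (m := m).
    by rewrite mcoeffX eqxx oner_eq0.
  by exists P; split=> //; [rewrite addm0|apply: lepm_trans Pm mc].
have ex (i : 'I_(size (msupp f))) : exists P,
    [/\ edge_sum e s P, (P <= tnth (in_tuple (msupp f)) i)%MM & (P <= c)%MM].
  have [|P [Ps Pm Pc]] := f_supp (tnth (in_tuple (msupp f)) i).
    by rewrite -mcoeff_msupp mem_tnth.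
  by exists P; split=> //; rewrite addm0 in Pm.
have [P PP] := fin_all_exists ex.
exists (size (msupp f)), (fun i => let m := tnth (in_tuple (msupp f)) i in
  f@_m *: 'X_[m - P i]), (fun i => 'X_[P i]); split=> [i|].
  have [Ps _ Pc] := PP i; exists (P i); split=> //.
  exact: edge_sum_ideal_pow.
rewrite {1}[f]mpolyE big_tnth; apply: eq_bigr => i _.
have [_ Pm _] := PP i.
by rewrite -scalerAl -mpolyXD submK.
Qed.

End Ideals.

(** * Shifts of a minimal resolution *)

Lemma int_max_exists (P : int -> Prop) (x b : int) :
  P x -> (forall y, P y -> y <= b) -> exists2 y, P y & forall z, P z -> z <= y.
Proof.
move=> Px Pb; have [k] := ubnP `|b - x|%N.
elim: k x Px => // k IH x Px le_k.
have [[y Py lt_xy]|nomax] := classic (exists2 y, P y & x < y).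
  by apply: (IH y) => //; have := Pb y Py; lia.
exists x => // y Py; rewrite leNgt; apply/negP => lt_xy.
by apply: nomax; exists y.
Qed.

Section Resolution.
Variables (K : fieldType) (n : nat) (U : 'X_{1..n} -> Prop) (r : nat).
Local Notation S := {mpoly K[n]}.
Variables (I : S -> Prop) (F : free_complex K n).
Hypothesis I_supp : forall f, I f <-> supported U f.
Hypothesis F_res : minimal_resolution I F.
Hypothesis regU : reg_le K U r.

Lemma aug_row p (v : 'M[S]_(p, fc_rank F 0)) i :
  I ((v *m fc_aug F) i 0).
Proof.
apply/(mr_aug_image F_res _); exists (row i v); rewrite !mxE.
by apply: eq_bigr => j _; rewrite mxE.
Qed.

(** Start of the dimension shifting: the row space of [fc_aug F] is I inside S, and the primitive
    given by [regU] lifts to F_0. *)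
Lemma mx_reg_le_aug : mx_reg_le (fc_aug F) (fun=> 0) r.
Proof.
move=> d v lt_d zK z_ord.
have [i m nz|y yE Uy] := regU lt_d zK.
  have U1 := (I_supp _).1 (aug_row v i); split; first exact: U1.
  by have := z_ord i 0 m nz; rewrite subr0.
have ex i : exists w : 'rV[S]_(fc_rank F 0), (w *m fc_aug F) 0 0 = y i 0.
  apply: (mr_aug_image F_res _).1; apply/I_supp.
  by apply: supportedW (Uy i) => m [].
have [w wE] := fin_all_exists ex.
exists (\matrix_i w i); rewrite -yE; congr (_ *m _).
apply/matrixP => i j; rewrite ord1 -wE !mxE.
by apply: eq_bigr => k _; rewrite mxE.
Qed.

(** The rows of [fc_diff F i] span the (i+1)-st syzygy module, and each syzygy step costs 1. *)
Lemma mx_reg_le_diff i :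
  mx_reg_le (fc_diff F i) (@fc_shift _ _ F i) (r%:Z + i.+1%:Z).
Proof.
elim: i => [|i IH].
  apply: mx_reg_le_syz mx_reg_le_aug.
  - by move=> p q; rewrite ord1 subr0; apply: (mr_aug_homog F_res).
  - exact: (mr_minimal F_res).
  - exact: (mr_exact0 F_res).
have -> : r%:Z + i.+2%:Z = r%:Z + i.+1%:Z + 1 by lia.
apply: mx_reg_le_syz IH.
- exact: (mr_diff_homog F_res).
- exact: (mr_minimal F_res).
- exact: (mr_exactS F_res).
Qed.

Lemma fc_shift_le i (p : 'I_(fc_rank F i)) : fc_shift p <= r%:Z + i%:Z.
Proof.
case: i p => [|i] p.
  rewrite addr0; apply: (shift_le _ _ _ mx_reg_le_aug).
  - by move=> p' q; rewrite ord1 subr0; apply: (mr_aug_homog F_res).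
  - exact: (mr_minimal F_res).
  - exact: (mr_exact0 F_res).
exact: (shift_le (@mr_diff_homog _ _ _ _ F_res i) (mr_minimal F_res (i := i.+1))
  (mr_exactS F_res (i := i)) (@mx_reg_le_diff i)).
Qed.

(** A nonzero f forces F_0 to have a basis element, so the set of all j - i is nonempty; being
    bounded by r, it has a maximum. *)
Lemma resolution_regularity f : I f -> f != 0 ->
  exists r', is_regularity F r' /\ r' <= r.
Proof.
move=> If nz_f; have [v vE] := (mr_aug_image F_res f).1 If.
have [p _] : exists p : 'I_(fc_rank F 0), true.
  apply/existsP; apply: contraNT nz_f => /existsPn nop.
  by rewrite -vE mxE big1 // => p; have := nop p.
have betti i (q : 'I_(fc_rank F i)) : graded_betti F i (fc_shift q) != 0%N.
  by rewrite -lt0n; apply/card_gt0P; exists q; rewrite inE.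
pose B x := exists (i : nat) (j : int), graded_betti F i j != 0%N /\ j - i%:Z = x.
have Bp : B (fc_shift p - 0%:Z) by exists 0%N, (fc_shift p).
have Br x : B x -> x <= r.
  case=> i [j [+ <-]]; rewrite -lt0n => /card_gt0P [q].
  by rewrite inE => /eqP <-; have := fc_shift_le q; lia.
have [y By maxy] := int_max_exists Bp Br.
exists y; split; last exact: Br; split=> // i j Bij.
by apply: maxy; exists i, j.
Qed.

End Resolution.

Theorem theorem5p6 (K : fieldType) (n : nat)
    (e : rel 'I_n) (e_sym : ssrbool.symmetric e) (e_irr : irreflexive e)
    (c : 'X_{1..n}) (delta : nat)
    (delta_max : is_delta c (edge_ideal K e) delta)
    (s : nat) (s_gt0 : (0 < s)%N) (s_le : (s <= delta)%N)
    (F : free_complex K n)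
    (F_res : minimal_resolution
               (bounded_part c (ideal_pow (edge_ideal K e) s)) F) :
  exists r : int, is_regularity F r /\ (r <= (delta + s)%N%:Z)%R.
Proof.
have in_bounded k P : edge_sum e k P -> (P <= c)%MM ->
    bounded_part c (ideal_pow (edge_ideal K e) k) 'X_[P].
  move=> Pk Pc; apply/bounded_partP; apply: supportedX.
  by exists P; split; rewrite ?addm0 ?lepm_refl.
have X_neq0 P : 'X_[K, P] != 0 :> {mpoly K[n]}.
  apply/eqP => /(congr1 (mcoeff P)); rewrite mcoeffX eqxx mcoeff0 => /eqP.
  by rewrite oner_eq0.
have [[f /bounded_partP f_supp nz_f] max_delta] := delta_max.
(* The leading monomial of f lies above a sum M of delta edges with M <= c, maximum by
   [max_delta]. *)
have [|M [Mdelta _ Mc]] := f_supp (mlead f).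
  by rewrite -mcoeff_msupp mlead_supp.
have [P Ps PM] := edge_sum_leq Mdelta s_le.
have regU : reg_le K (colon_mono e c 0 s) (delta + s).
  (* For A = 0 the cap vanishes. *)
  have -> : (delta + s = delta + s - cap 0%MM M)%N.
    by rewrite /cap big1 ?subn0 // => i _; rewrite mnm0E min0n.
  apply: reg_le_colon => // [|l N Nl Nc].
    by apply/mnm_lepP => i; rewrite mnm0E.
  by apply: max_delta; exists 'X_[N] => //; apply: in_bounded.
apply: (resolution_regularity _ F_res regU (f := 'X_[P])) => //.
  by move=> g; apply: bounded_partP.
by apply: in_bounded => //; apply: lepm_trans PM Mc.
Qed.
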